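(* Let $k$ be a field with $u(k)\leq 2$ which is not quadratically closed, with $\mathrm{char}(k)\neq 2$ and $|k|\geq 5$. Let $G:=\mathrm{PSL}_2(k)$ and let $\mathscr{C}$ be a semisimple conjugacy class in $G$. (1) If $\mathscr{C}$ is split semisimple, then $\mathscr{C}^2=G$. (2) If $\mathscr{C}$ is non-split semisimple, then $\mathscr{C}^2=G$ unless $\mathrm{tr}(\mathscr{C})=0$, in which case $-1\notin k^{\times 2}$ and $\mathscr{C}^2=G\setminus\{\text{unipotent elements}\}$. In particular, if $-1\in k^{\times 2}$, then $\mathscr{C}^2=G$.
   Context: A field $k$ has $u$-invariant $\le 2$, written $u(k)\leq 2$, if every quadratic form in $3$ variables over $k$ is isotropic. A field is quadratically closed if it admits no quadratic extension. $k^{\times 2}$ denotes the set of squares in $k^\times$. For $x\in \mathrm{SL}_2(k)$, $\bar x$ denotes its image in $\mathrm{PSL}_2(k)=\mathrm{SL}_2(k)/\{\pm I\}$. ''Semisimple element (or class)'' always means a non-central semisimple element (or class); in $\mathrm{PSL}_2(k)$, a semisimple element is the image $\bar x$ of a semisimple $x\in \mathrm{SL}_2(k)$. It is split if $x$ is diagonalizable over $k$ (eigenvalues $\alpha,\alpha^{-1}$ with $\alpha\in k^\times\setminus\{\pm1\}$), and non-split if the characteristic polynomial $X^2-\mathrm{tr}(x)X+1$ is irreducible over $k$. Unipotent elements of $\mathrm{PSL}_2(k)$ are the images of the non-identity unipotent elements of $\mathrm{SL}_2(k)$; thus the identity is not counted as unipotent. The trace $\mathrm{tr}(\mathscr{C})$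 of the class of $\bar x$ is $\mathrm{tr}(x)$, well defined up to sign, so the condition $\mathrm{tr}(\mathscr{C})=0$ is meaningful. $\mathscr{C}^2=\{xy: x,y\in\mathscr{C}\}$. *)

(* Defs.v *)
From HB Require Import structures.
From mathcomp Require Import all_boot all_algebra all_field.
From mathcomp Require Import boolp classical_sets.
From mathcomp Require Import mpoly.

Set Implicit Arguments.
Unset Strict Implicit.
Unset Printing Implicit Defensive.

Import GRing.Theory.

Local Open Scope classical_set_scope.
Local Open Scope quotient_scope.
Local Open Scope ring_scope.

Definition isotropic (k : fieldType) (n : nat) (q : {mpoly k[n]}) : Prop :=
  exists2 v : 'rV[k]_n, v != 0 & q.@[fun i => v 0 i] = 0.

(* u(k) <= 2: a quadratic form in 3 variables is a homogeneous polynomial of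
   degree 2; it may be degenerate or zero, and is then isotropic anyway. *)
Definition u_invariant_le2 (k : fieldType) : Prop :=
  forall q : {mpoly k[3]}, q \is 2.-homog -> isotropic q.

Definition quadratically_closed (k : fieldType) : Prop :=
  forall L : fieldExtType k, \dim {: L} <> 2%N.

Definition unit_squares (k : fieldType) : set k :=
  [set a ^+ 2 | a in [set a : k | a != 0]].
Arguments unit_squares : clear implicits.

Section SL2.
Variable k : fieldType.

Record SL2 : Type := MkSL2 { SL2_mx :> 'M[k]_2; SL2_det : \det SL2_mx == 1 }.

HB.instance Definition _ := [isSub for SL2_mx].
HB.instance Definition _ := [Choice of SL2 by <:].

Implicit Types x y z : SL2.

Lemma det_SL2 x : \det x = 1.
Proof. exact/eqP/SL2_det. Qed.

Fact SL2_one_subproof : \det (1%:M : 'M[k]_2) == 1.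
Proof. by rewrite det1. Qed.
Definition SL2_one := MkSL2 SL2_one_subproof.

Fact SL2_mul_subproof x y : \det (x *m y) == 1.
Proof. by rewrite det_mulmx !det_SL2 mul1r. Qed.
Definition SL2_mul x y := MkSL2 (SL2_mul_subproof x y).

Fact SL2_inv_subproof x : \det (invmx x) == 1.
Proof. by rewrite det_inv det_SL2 invr1. Qed.
Definition SL2_inv x := MkSL2 (SL2_inv_subproof x).

Fact SL2_opp_subproof x : \det (- (x : 'M[k]_2)) == 1.
Proof. by rewrite -scaleN1r detZ det_SL2 mulr1 sqrrN expr1n. Qed.
Definition SL2_opp x := MkSL2 (SL2_opp_subproof x).

Lemma SL2_unitmx x : (x : 'M[k]_2) \in unitmx.
Proof. by rewrite unitmxE det_SL2 unitr1. Qed.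

Fact SL2_mulA : associative SL2_mul.
Proof. by move=> x y z; apply: val_inj; rewrite /= mulmxA. Qed.
Fact SL2_mul1 : left_id SL2_one SL2_mul.
Proof. by move=> x; apply: val_inj; rewrite /= mul1mx. Qed.
Fact SL2_mulr1 : right_id SL2_one SL2_mul.
Proof. by move=> x; apply: val_inj; rewrite /= mulmx1. Qed.
Fact SL2_mulV : left_inverse SL2_one SL2_inv SL2_mul.
Proof. by move=> x; apply: val_inj; rewrite /= mulVmx ?SL2_unitmx. Qed.
Fact SL2_mulrV : right_inverse SL2_one SL2_inv SL2_mul.
Proof. by move=> x; apply: val_inj; rewrite /= mulmxV ?SL2_unitmx. Qed.

HB.instance Definition _ :=
  isGroup.Build SL2 SL2_mulA SL2_mul1 SL2_mulr1 SL2_mulV SL2_mulrV.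

Definition eq_upto_sign : rel SL2 := fun x y => (x == y) || (x == SL2_opp y).

Lemma SL2_oppK : involutive SL2_opp.
Proof. by move=> x; apply: val_inj; rewrite /= opprK. Qed.
Lemma SL2_mulNr x y : (SL2_opp x * y)%g = SL2_opp (x * y)%g.
Proof. by apply: val_inj; rewrite /= mulNmx. Qed.
Lemma SL2_mulrN x y : (x * SL2_opp y)%g = SL2_opp (x * y)%g.
Proof. by apply: val_inj; rewrite /= mulmxN. Qed.

Fact eq_upto_sign_equiv : equiv_class_of eq_upto_sign.
Proof.
split.
- by move=> x; rewrite /eq_upto_sign eqxx.
- move=> x y; rewrite /eq_upto_sign eq_sym; congr (_ || _).
  by apply/eqP/eqP=> ->; rewrite SL2_oppK.
- move=> y x z /orP[]/eqP-> // /orP[]/eqP->; apply/orP; first by right.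
  by left; rewrite SL2_oppK.
Qed.
Canonical eq_upto_sign_rel := EquivRelPack eq_upto_sign_equiv.

Definition PSL2 : Type := {eq_quot eq_upto_sign}.
HB.instance Definition _ := Choice.on PSL2.
HB.instance Definition _ := EqQuotient.on PSL2.

Definition bar (x : SL2) : PSL2 := \pi_PSL2 x.

Lemma bar_eq x y : (bar x == bar y) = (x == y) || (x == SL2_opp y).
Proof. by rewrite eqmodE. Qed.

Lemma bar_opp x : bar (SL2_opp x) = bar x.
Proof. by apply/eqP; rewrite bar_eq eqxx orbT. Qed.

Lemma bar_reprP (X : PSL2) : bar (repr X) = X.
Proof. exact: reprK. Qed.

Lemma repr_bar x : repr (bar x) = x \/ repr (bar x) = SL2_opp x.
Proof.
have : bar (repr (bar x)) == bar x by rewrite bar_reprP.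
by rewrite bar_eq => /orP[]/eqP; [left|right].
Qed.

Definition PSL2_mul (X Y : PSL2) : PSL2 := bar (repr X * repr Y)%g.
Definition PSL2_inv (X : PSL2) : PSL2 := bar (repr X)^-1%g.

Fact PSL2_mulE x y : PSL2_mul (bar x) (bar y) = bar (x * y)%g.
Proof.
by rewrite /PSL2_mul; case: (repr_bar x) => ->; case: (repr_bar y) => ->;
   rewrite ?SL2_mulNr ?SL2_mulrN ?bar_opp.
Qed.

Fact PSL2_mulA : associative PSL2_mul.
Proof.
move=> X Y Z; rewrite -(bar_reprP X) -(bar_reprP Y) -(bar_reprP Z).
by rewrite !PSL2_mulE mulgA.
Qed.
Fact PSL2_mul1 : left_id (bar 1%g) PSL2_mul.
Proof. by move=> X; rewrite -(bar_reprP X) PSL2_mulE mul1g. Qed.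
Fact PSL2_mulr1 : right_id (bar 1%g) PSL2_mul.
Proof. by move=> X; rewrite -(bar_reprP X) PSL2_mulE mulg1. Qed.
Fact PSL2_mulV : left_inverse (bar 1%g) PSL2_inv PSL2_mul.
Proof. by move=> X; rewrite -{2}(bar_reprP X) PSL2_mulE mulVg. Qed.
Fact PSL2_mulrV : right_inverse (bar 1%g) PSL2_inv PSL2_mul.
Proof. by move=> X; rewrite -{1}(bar_reprP X) PSL2_mulE mulgV. Qed.

HB.instance Definition _ :=
  isGroup.Build PSL2 PSL2_mulA PSL2_mul1 PSL2_mulr1 PSL2_mulV PSL2_mulrV.

Fact bar_is_mul : {morph bar : x y / (x * y)%g}.
Proof. by move=> x y; rewrite -PSL2_mulE. Qed.
HB.instance Definition _ := isMultiplicative.Build SL2 PSL2 bar bar_is_mul.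
HB.instance Definition _ :=
  Multiplicative_isUMagmaMorphism.Build SL2 PSL2 bar (erefl _).

(* Diagonalizable over some extension field of k, i.e. over an
   algebraic closure of k, and not central. *)
Definition semisimple (x : SL2) : Prop :=
  (exists (L : fieldType) (f : {rmorphism k -> L}),
      diagonalizable (map_mx f x)) /\
  ~ (forall y : SL2, commute x y).

Definition split_semisimple (x : SL2) : Prop :=
  semisimple x /\ diagonalizable (x : 'M[k]_2).

Definition nonsplit_semisimple (x : SL2) : Prop :=
  semisimple x /\ irreducible_poly (char_poly x).

Definition unipotent (x : SL2) : Prop :=
  exists n : nat, ((x : 'M[k]_2) - 1) ^+ n = 0.

Definition unipotents : set PSL2 :=
  [set bar x | x in [set x : SL2 | unipotent x /\ x <> 1%g]].

End SL2.
Arguments unipotents : clear implicits.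

Definition conj_class (G : groupType) (g : G) : set G :=
  range (fun h : G => (g ^ h)%g).

Definition set_square (G : groupType) (C : set G) : set G :=
  [set (x * y)%g | x in C & y in C].

Section Classes.
Variable k : fieldType.

(* C is the conjugacy class in PSL2 of the image of some x satisfying P. *)
Definition class_of_type (P : SL2 k -> Prop) (C : set (PSL2 k)) : Prop :=
  exists2 x : SL2 k, P x & C = conj_class (bar x).

Definition semisimple_class := class_of_type (@semisimple k).
Definition split_semisimple_class := class_of_type (@split_semisimple k).
Definition nonsplit_semisimple_class := class_of_type (@nonsplit_semisimple k).

(* The trace of a class is only defined up to sign; it is recorded as the set
   of all its values, see class_traceE. *)
Definition class_trace (C : set (PSL2 k)) : set k :=
  [set \tr (x : 'M[k]_2) | x in [set x : SL2 k | C (bar x)]].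

Lemma class_traceE (x : SL2 k) :
  class_trace (conj_class (bar x)) = [set \tr x; - \tr x].
Proof.
have trJ (y : SL2 k) : \tr (x ^ y)%g = \tr x.
  by rewrite /conjg /= mxtrace_mulC -mulmxA mulmxV ?SL2_unitmx ?mulmx1.
apply/seteqP; split=> [_ [y [Z _ xZy] <-]|t].
- move: xZy; rewrite -(bar_reprP Z) -gmulfJ => /eqP; rewrite eq_sym bar_eq.
  case/orP=> /eqP->; first by left.
  by right; rewrite /= raddfN /= (trJ (repr Z)).
- case=> ->.
  + by exists x => //; exists 1%g => //; rewrite conjg1.
  + exists (SL2_opp x); last by rewrite raddfN.
    by exists 1%g => //; rewrite conjg1 bar_opp.
Qed.

End Classes.

(* Main.v *)
(* Write t for the trace of x, so that t^2 <> 4.  If s^2 <> 4, then u(k) <= 2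
   makes every affine conic a^2 + s a b + b^2 + l a + m b + n = 0 have a
   k-point.  For l = m = 0 this says that the norm form of k[x] represents all
   of k^*, so the class of the image of x consists of all elements of trace t
   or -t.  Hence the image of g lies in the square of the class iff some y in
   SL_2(k) has tr y = t and tr (y g) = r with r = t or r = -t.  After
   conjugating g to a companion matrix, such y correspond to the points of
   a^2 + s a b + b^2 - t a - r b + 1 = 0 with s = tr g.  If s^2 <> 4 there is
   a point.  If g is unipotent up to sign, there is one when t <> 0, while for
   t = 0 the equation reads (a + b)^2 = -1. *)

Require Import Defs.
From HB Require Import structures.
From mathcomp Require Import all_boot all_algebra all_field.
From mathcomp Require Import boolp classical_sets.
From mathcomp Require Import mpoly.
From mathcomp Require Import ring.

Set Implicit Arguments.
Unset Strict Implicit.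
Unset Printing Implicit Defensive.

Import GRing.Theory.

Local Open Scope classical_set_scope.
Local Open Scope ring_scope.

(** * Affine points on conics *)

(** Homogenising gives a ternary form, but its isotropic vector may lie at infinity. Since
    [s ^+ 2 != 4], the binary form at infinity is nondegenerate, so such a point is smooth and
    yields an affine one. *)
Lemma affine_conic_point (k : fieldType) (s l m n : k) :
  u_invariant_le2 k -> s ^+ 2 != 4 ->
  exists a b, a ^+ 2 + s * a * b + b ^+ 2 + l * a + m * b + n = 0.
Proof.
move=> u_le2 s2.
pose X (i : 'I_3) : {mpoly k[3]} := 'X_i.
pose q : {mpoly k[3]} :=
  X 0 * X 0 + s *: (X 0 * X 1) + X 1 * X 1
  + l *: (X 0 * X 2) + m *: (X 1 * X 2) + n *: (X 2 * X 2).
have qhom : q \is 2.-homog.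
  have X2 i j : X i * X j \is 2.-homog.
    by apply: (@dhomogM _ _ _ 1 _ 1); rewrite dhomogX; apply/eqP/mdeg1.
  by rewrite /q; repeat apply: dhomogD; rewrite ?dhomogZ ?X2.
have [v v0] := u_le2 q qhom.
rewrite /q !(mevalD, mevalZ, mevalM) /X !mevalXU.
set a := v 0 0; set b := v 0 1; set c := v 0 2 => qv0.
have [c0|c_neq0] := eqVneq c 0; last first.
  exists (a / c), (b / c).
  by apply: (mulfI (mulf_neq0 c_neq0 c_neq0)); rewrite mulr0 -[RHS]qv0; field.
have {qv0}ab0 : a ^+ 2 + s * a * b + b ^+ 2 = 0.
  by rewrite -[RHS]qv0 c0; ring.
(* [(a : b : 0)] lies on the conic: the line joining it to an affine point
   [(x, y)] not on its tangent meets the conic in a second, affine point. *)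
suff [x [y xy]] : exists x y,
    (2 * a + s * b) * x + (s * a + 2 * b) * y + l * a + m * b = 1.
  set f := x ^+ 2 + s * x * y + y ^+ 2 + l * x + m * y + n.
  (* At [(x - u * a, y - u * b)] the polynomial takes the value [f - u], by [ab0] and the
     normalisation [xy]; hence [u = f]. *)
  exists (x - f * a), (y - f * b).
  transitivity (f * (1 - ((2 * a + s * b) * x + (s * a + 2 * b) * y + l * a + m * b))
                + f ^+ 2 * (a ^+ 2 + s * a * b + b ^+ 2)); first by rewrite /f; ring.
  by rewrite xy ab0 subrr !mulr0 addr0.
have [p0|p_neq0] := eqVneq (2 * a + s * b) 0; last first.
  exists ((1 - l * a - m * b) / (2 * a + s * b)), 0.
  by rewrite mulrC divfK //; ring.
have [r0|r_neq0] := eqVneq (s * a + 2 * b) 0; last first.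
  exists 0, ((1 - l * a - m * b) / (s * a + 2 * b)).
  by rewrite [_ * (_ / _)]mulrC divfK //; ring.
(* Both partial derivatives of the form at infinity vanish at [(a, b)]. This linear system has
   determinant [4 - s ^+ 2], so [a = b = 0], contradicting [v != 0]. *)
have s4 : s ^+ 2 - 4 != 0 by rewrite subr_eq0.
have a0 : a = 0.
  apply: (mulfI s4); rewrite mulr0.
  transitivity (s * (s * a + 2 * b) - 2 * (2 * a + s * b)); first by ring.
  by rewrite p0 r0; ring.
have b0 : b = 0.
  apply: (mulfI s4); rewrite mulr0.
  transitivity (s * (2 * a + s * b) - 2 * (s * a + 2 * b)); first by ring.
  by rewrite p0 r0; ring.
case/negP: v0; apply/eqP/rowP=> i; rewrite mxE.
by case: i => [[|[|[|//]]] i3]; [rewrite -a0 | rewrite -b0 | rewrite -c0];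
  congr (v _ _); apply: val_inj.
Qed.

(** * Entrywise calculus of 2 x 2 matrices *)

Section Matrices22.
Variable R : comNzRingType.
Implicit Types M N : 'M[R]_2.

Definition mx22 (a b c d : R) : 'M[R]_2 :=
  \matrix_(i, j) if i == 0 then (if j == 0 then a else b)
                 else (if j == 0 then c else d).

Lemma mx22P M N :
  [/\ M 0 0 = N 0 0, M 0 1 = N 0 1, M 1 0 = N 1 0 & M 1 1 = N 1 1] -> M = N.
Proof.
case=> e00 e01 e10 e11; apply/matrixP=> i j.
have ord2 (l : 'I_2) : l = 0 \/ l = 1.
  by case: l => [[|[|//]] l2]; [left | right]; apply: val_inj.
by case: (ord2 i) => ->; case: (ord2 j) => ->.
Qed.

Lemma mulmx22E M N i j : (M *m N) i j = M i 0 * N 0 j + M i 1 * N 1 j.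
Proof.
by rewrite mxE big_ord_recl big_ord1; congr (_ + M i _ * N _ j); apply: val_inj.
Qed.

Lemma mxtrace22 M : \tr M = M 0 0 + M 1 1.
Proof. by rewrite /mxtrace big_ord_recl big_ord1; congr (_ + M _ _); apply: val_inj. Qed.

Lemma det22 M : \det M = M 0 0 * M 1 1 - M 0 1 * M 1 0.
Proof.
rewrite (expand_det_row _ 0) big_ord_recl big_ord1 /cofactor !det_mx11 !mxE /=.
rewrite !expr0 !expr1 mul1r mulN1r mulrN.
by congr (M _ _ * M _ _ - M _ _ * M _ _); apply: val_inj.
Qed.

Lemma scalar_mx22P M :
  M 0 1 = 0 -> M 1 0 = 0 -> M 0 0 = M 1 1 -> M = (M 0 0)%:M.
Proof. by move=> e01 e10 e; apply: mx22P; rewrite !mxE /= mulr1n mulr0n. Qed.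

Lemma cayley_hamilton22 M : M *m M = \tr M *: M - (\det M)%:M.
Proof.
apply: mx22P; rewrite !mulmx22E !mxE /= mulr1n mulr0n mxtrace22 det22.
by split; ring.
Qed.

End Matrices22.

(** * Companion form and prescribed traces *)

Section Similarity.
Variable k : fieldType.
Implicit Types M P : 'M[k]_2.

(** A row vector [v] independent of [v *m M] gives a basis in which, by Cayley-Hamilton, [M] becomes
    its companion matrix. *)
Lemma companion_similar M :
  ~~ is_scalar_mx M ->
  exists2 P, P \in unitmx & P *m M = mx22 0 1 (- \det M) (\tr M) *m P.
Proof.
move=> nsM.
have cyclic p q :
    p * (p * M 0 1 + q * M 1 1) - q * (p * M 0 0 + q * M 1 0) != 0 ->
  exists2 P, P \in unitmx & P *m M = mx22 0 1 (- \det M) (\tr M) *m P.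
  move=> dP; exists (mx22 p q (p * M 0 0 + q * M 1 0) (p * M 0 1 + q * M 1 1)).
    by rewrite unitmxE det22 !mxE /= unitfE.
  by apply: mx22P; rewrite !mulmx22E mxtrace22 det22 !mxE /=; split; ring.
have [e01|?] := eqVneq (M 0 1) 0; last first.
  by apply: (cyclic 1 0); rewrite !mul1r !mul0r addr0 subr0.
have [e10|?] := eqVneq (M 1 0) 0; last first.
  by apply: (cyclic 0 1); rewrite !mul1r !mul0r !add0r oppr_eq0.
(* Both coordinate vectors are eigenvectors, so [M] is diagonal; their sum is cyclic unless the
   diagonal entries agree. *)
apply: (cyclic 1 1); rewrite e01 e10 !mul1r add0r addr0 subr_eq0.
by apply: contra nsM => /eqP e; apply/is_scalar_mxP; exists (M 0 0); apply: scalar_mx22P.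
Qed.

Lemma mxtrace_conj M P : P \in unitmx -> \tr (P *m M *m invmx P) = \tr M.
Proof. by move=> uP; rewrite -mulmxA mxtrace_mulC -mulmxA mulVmx ?mulmx1. Qed.

Lemma det_conj M P : P \in unitmx -> \det (P *m M *m invmx P) = \det M.
Proof. by move=> uP; rewrite !det_mulmx mulrAC -det_mulmx mulmxV // det1 mul1r. Qed.

(** Once [g] is the companion matrix [K], the two trace conditions determine [y] from its entries
    [a = y 1 1] and [b = - y 0 1]; the conic is then the equation [\det y = 1]. *)
Lemma trace_pair_conic (g : 'M[k]_2) (t r : k) :
    ~~ is_scalar_mx g -> \det g = 1 ->
  (exists y : 'M[k]_2, [/\ \det y = 1, \tr y = t & \tr (y *m g) = r]) <->
  exists a b, a ^+ 2 + \tr g * a * b + b ^+ 2 - t * a - r * b + 1 = 0.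
Proof.
move=> nsg dg; have [P uP] := companion_similar nsg; rewrite dg.
set K := mx22 _ _ _ _ => PgKP.
have gE : g = invmx P *m K *m P by rewrite -mulmxA -PgKP mulKmx.
have KE : K = P *m g *m invmx P by rewrite PgKP mulmxK.
have uV : invmx P \in unitmx by rewrite unitmx_inv.
split=> [[y [dy ty yg]]|[a [b ab]]].
- pose z := P *m y *m invmx P.
  have dz : \det z = 1 by rewrite det_conj.
  have tz : \tr z = t by rewrite mxtrace_conj.
  have zK : \tr (z *m K) = r.
    by rewrite KE /z -!mulmxA mulKmx // !mulmxA -(mulmxA P) mxtrace_conj.
  clearbody z; exists (z 1 1), (- z 0 1); move: zK dz.
  rewrite mxtrace22 !mulmx22E det22 !mxE /= -tz (mxtrace22 z) => <- dz.
  by transitivity (1 - (z 0 0 * z 1 1 - z 0 1 * z 1 0)); [ring | rewrite dz subrr].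
- pose z := mx22 (t - a) (- b) (r - b - a * \tr g) a.
  exists (invmx P *m z *m P).
  rewrite -{2 4}(invmxK P) det_conj // mxtrace_conj //; split.
  + rewrite det22 !mxE /=.
    transitivity (1 - (a ^+ 2 + \tr g * a * b + b ^+ 2 - t * a - r * b + 1)); first by ring.
    by rewrite ab subr0.
  + by rewrite mxtrace22 !mxE /=; ring.
  + rewrite gE -!mulmxA mulKVmx // !mulmxA -(mulmxA _ z) -{2}(invmxK P).
    by rewrite mxtrace_conj // mxtrace22 !mulmx22E !mxE /=; ring.
Qed.

End Similarity.

(** * Conjugacy classes described by traces *)

Section Classes.
Variable k : fieldType.
Implicit Types x y g h : SL2 k.

Lemma nonscalar_trace x : \tr x ^+ 2 != 4 -> ~~ is_scalar_mx x.
Proof.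
apply: contra => /is_scalar_mxP[a xE]; have := det_SL2 x.
rewrite xE mxtrace_scalar det_scalar => a2.
by rewrite exprMn_n a2.
Qed.

(** Both matrices are similar to the same companion matrix [K], but the conjugator only lies in GL2.
    An element of the centraliser of [K] corrects its determinant. *)
Lemma trace_conjugate x y :
    u_invariant_le2 k -> \tr x ^+ 2 != 4 -> \tr y = \tr x ->
  exists h, (x ^ h)%g = y.
Proof.
move=> u_le2 t4 tyx.
have [P uP] := companion_similar (nonscalar_trace t4).
have [|Q uQ] := @companion_similar _ y; first by rewrite nonscalar_trace ?tyx.
rewrite !det_SL2 tyx; set K := mx22 _ _ _ _ => QyKQ PxKP.
(* The determinant of [a%:M + b *: K] is the norm form [a ^+ 2 + \tr x * a * b + b ^+ 2]. *)
have [a [b ab]] := affine_conic_point 0 0 (- (\det Q / \det P)) u_le2 t4.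
pose S : 'M[k]_2 := a%:M + b *: K.
have dS : \det S = \det Q / \det P.
  apply/eqP; rewrite -subr_eq0 -ab det22 !mxE /= mulr1n mulr0n; apply/eqP; ring.
have SK : S *m K = K *m S.
  by rewrite mulmxDl mulmxDr -scalemxAl -scalemxAr scalar_mxC.
have dP : \det P != 0 by rewrite -unitfE -unitmxE.
have dQ : \det Q != 0 by rewrite -unitfE -unitmxE.
have dSP : \det (S *m P) = \det Q by rewrite det_mulmx dS divfK.
have uSP : S *m P \in unitmx by rewrite unitmxE dSP unitfE.
have dh : \det (invmx (S *m P) *m Q) == 1.
  by rewrite det_mulmx det_inv dSP mulVf.
exists (MkSL2 dh); rewrite conjgE; apply: (canLR (mulKg _)).
apply: val_inj => /=; apply: (can_inj (mulKmx uSP)).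
rewrite -(mulmxA _ Q) mulKVmx // !mulmxA.
rewrite -(mulmxA S) PxKP mulmxA SK -(mulmxA K) -[_ *m invmx _ *m _]mulmxA -mulmxA.
by rewrite mulKVmx ?QyKQ.
Qed.

Lemma bar_surj (X : PSL2 k) : exists x, X = bar x.
Proof. by exists (repr X); rewrite bar_reprP. Qed.

Lemma mxtraceV x : \tr (x^-1)%g = \tr x.
Proof.
have /(canRL (mulKmx (SL2_unitmx x))) : (x : 'M_2) *m ((\tr x)%:M - (x : 'M_2)) = 1%:M.
  rewrite mulmxBr cayley_hamilton22 det_SL2 mul_mx_scalar.
  by rewrite opprB addrCA subrr addr0.
rewrite mulmx1 => /= <-.
by rewrite raddfB /= mxtrace_scalar mulr2n addrK.
Qed.

Lemma bar_trace x y : bar x = bar y -> \tr x = \tr y \/ \tr x = - \tr y.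
Proof.
by move/eqP; rewrite bar_eq => /orP[]/eqP->; [left | right; rewrite /= raddfN].
Qed.

Lemma mem_class x y :
    u_invariant_le2 k -> \tr x ^+ 2 != 4 ->
  conj_class (bar x) (bar y) <-> \tr y = \tr x \/ \tr y = - \tr x.
Proof.
move=> u_le2 t4; split=> [Cy|[] tyx].
- have : class_trace (conj_class (bar x)) (\tr y) by exists y.
  by rewrite class_traceE.
- have [h <-] := trace_conjugate u_le2 t4 tyx.
  by exists (bar h) => //; rewrite gmulfJ.
- have [|h xh] := @trace_conjugate x (SL2_opp y) u_le2 t4.
    by rewrite /= raddfN /= tyx opprK.
  by exists (bar h) => //; rewrite -gmulfJ xh; apply: bar_opp.
Qed.

(** Factor [g] as [y^-1 * (y * g)], where [y^-1] and [y] have the same trace. Changing the sign of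
    [y] makes its trace [\tr x], so the sign ambiguity remains only in [r]. *)
Lemma mem_class_square x g :
    u_invariant_le2 k -> \tr x ^+ 2 != 4 ->
  set_square (conj_class (bar x)) (bar g) <->
  exists r, (r = \tr x \/ r = - \tr x) /\
    exists y : 'M[k]_2, [/\ \det y = 1, \tr y = \tr x & \tr (y *m g) = r].
Proof.
move=> u_le2 t4; split=> [[Y CY [Z CZ]]|[r [rx [y [dy ty yg]]]]].
- have [y yE] := bar_surj Y; have [z zE] := bar_surj Z; subst Y Z.
  move=> yzg.
  move: CY CZ => /(mem_class _ u_le2 t4) ty /(mem_class _ u_le2 t4) tz.
  have /bar_trace tyg : bar (y^-1 * g)%g = bar z.
    by apply: (mulgI (bar y)); rewrite -bar_is_mul mulVKg.
  have {tz}tyg : \tr (y^-1 * g)%g = \tr x \/ \tr (y^-1 * g)%g = - \tr x.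
    by case: tyg => ->; case: tz => ->; rewrite ?opprK; auto.
  case: ty => ty.
    exists (\tr (y^-1 * g)%g); split=> //; exists (y^-1)%g.
    by split=> //; [rewrite det_SL2 | rewrite mxtraceV].
  exists (- \tr (y^-1 * g)%g); split.
    by case: tyg => ->; rewrite ?opprK; auto.
  exists (SL2_opp (y^-1)%g); split; first by rewrite det_SL2.
    by rewrite /= raddfN /= mxtraceV ty opprK.
  by rewrite /= mulNmx raddfN.
- have dy1 : \det y == 1 by apply/eqP.
  pose y' := MkSL2 dy1.
  exists (bar (y'^-1)%g); first by apply/mem_class => //; left; rewrite mxtraceV.
  exists (bar (y' * g)%g); last by rewrite -bar_is_mul mulKg.
  by apply/mem_class => //=; rewrite yg.
Qed.

Lemma scalar_SL2 x : is_scalar_mx x -> bar x = 1%g.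
Proof.
case/is_scalar_mxP=> a xE; apply/eqP; rewrite (bar_eq x 1%g).
have := det_SL2 x; rewrite xE det_scalar => /eqP; rewrite sqrf_eq1.
case/orP=> /eqP aE; apply/orP; [left|right]; apply/eqP/val_inj; rewrite /= xE aE //.
by rewrite raddfN.
Qed.

(** If [\tr x ^+ 2 = 4], the discriminant of the characteristic polynomial vanishes. The two
    eigenvalues then agree, so a diagonalizable [x] is scalar, hence central. *)
Lemma semisimple_trace x :
  2%N \notin [pchar k] -> semisimple x -> \tr x ^+ 2 != 4.
Proof.
move=> char2 [[L [f [P uP]]]] /diagonalizable_forPex[D] /(similarP uP) PxDP ncx.
apply/eqP => t4; apply: ncx => y.
have fxE : map_mx f x = invmx P *m diag_mx D *m P by rewrite -mulmxA -PxDP mulKmx.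
have trD : \tr (diag_mx D) = f (\tr x).
  by rewrite -trace_map_mx fxE -mulmxA mxtrace_mulC -mulmxA mulmxV ?mulmx1.
have detD : \det (diag_mx D) = 1.
  have := congr1 determinant fxE.
  by rewrite !det_mulmx mulrAC -det_mulmx mulVmx // det1 mul1r det_map_mx det_SL2 rmorph1.
have dD : D 0 0 = D 0 1.
  apply/eqP; rewrite -subr_eq0 -sqrf_eq0; apply/eqP.
  have -> : (D 0 0 - D 0 1) ^+ 2 = \tr (diag_mx D) ^+ 2 - 4 * \det (diag_mx D).
    by rewrite mxtrace22 det22 !mxE /= !mulr1n !mulr0n; ring.
  by rewrite trD detD -rmorphXn t4 rmorph_nat mulr1 subrr.
have DE : diag_mx D = (D 0 0)%:M.
  by apply: mx22P; rewrite !mxE /= !mulr1n !mulr0n -dD.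
have fx_scalar : map_mx f x = (D 0 0)%:M.
  by rewrite fxE DE scalar_mxC -mulmxA mulVmx ?mulmx1.
have entry i j : f ((x : 'M_2) i j) = (D 0 0)%:M i j by rewrite -fx_scalar mxE.
have xE : (x : 'M_2) = ((x : 'M_2) 0 0)%:M.
  by apply: scalar_mx22P; apply: (fmorph_inj f); rewrite ?rmorph0 !entry !mxE.
by apply: val_inj; rewrite /= xE scalar_mxC.
Qed.

(** * Elements of the square of a class *)

Lemma class_square_one x :
    u_invariant_le2 k -> \tr x ^+ 2 != 4 ->
  set_square (conj_class (bar x)) 1%g.
Proof.
move=> u_le2 t4; exists (bar x); first by apply/mem_class => //; left.
exists (bar (x^-1)%g); last by rewrite -bar_is_mul mulgV.
by apply/mem_class => //; left; rewrite mxtraceV.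
Qed.

Lemma class_square_trace_ne x g :
    u_invariant_le2 k -> \tr x ^+ 2 != 4 -> \tr g ^+ 2 != 4 ->
  set_square (conj_class (bar x)) (bar g).
Proof.
move=> u_le2 t4 s4; apply/mem_class_square => //; exists (\tr x); split; first by left.
apply/trace_pair_conic; rewrite ?nonscalar_trace ?det_SL2 //.
have [a [b ab]] := affine_conic_point (- \tr x) (- \tr x) 1 u_le2 s4.
by exists a, b; rewrite -!mulNr.
Qed.

(** The quadratic part of the conic is now the square [(a + b) ^+ 2]. For [\tr x != 0], taking
    [r = - \tr x] gives a point on the line [a + b = 0]. *)
Lemma class_square_trace2 x g :
    u_invariant_le2 k -> 2%N \notin [pchar k] -> \tr x ^+ 2 != 4 ->
    ~~ is_scalar_mx g -> \tr g = 2 ->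
  set_square (conj_class (bar x)) (bar g) <->
  \tr x != 0 \/ unit_squares k (-1).
Proof.
move=> u_le2 char2 t4 nsg s2; rewrite mem_class_square //.
have n2 : (2 : k) != 0 by apply: contra char2 => n2; rewrite inE.
split=> [[r [rx /(trace_pair_conic _ _ nsg (det_SL2 g))[a [b]]]]|].
- rewrite s2; have [t0 | _] := eqVneq (\tr x) 0; last by left.
  have -> : r = 0 by case: rx => ->; rewrite t0 ?oppr0.
  rewrite t0 => ab; right; have ab1 : (a + b) ^+ 2 = -1.
    by apply/eqP; rewrite -subr_eq0 opprK -ab; apply/eqP; ring.
  exists (a + b) => //=; apply/eqP => ab0; move/eqP: ab1.
  by rewrite ab0 expr0n /= eq_sym oppr_eq0 oner_eq0.
- have [t0 [] // [i _ i2]|t0 _] := eqVneq (\tr x) 0.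
    exists 0; split; first by left.
    apply/trace_pair_conic; rewrite ?det_SL2 // s2 t0.
    by exists i, 0; rewrite !(mulr0, mul0r, addr0, subr0, expr0n) i2 addNr.
  (* With [r = \tr x] the conic degenerates to
     [(a + b - \tr x / 2) ^+ 2 = \tr x ^+ 2 / 4 - 1], which may have no point; the sign [r = - \tr x] leaves a parabola. *)
  exists (- \tr x); split; first by right.
  apply/trace_pair_conic; rewrite ?det_SL2 // s2.
  by exists ((2 * \tr x)^-1), (- (2 * \tr x)^-1); field; rewrite n2 t0.
Qed.

Lemma class_squareT x :
    u_invariant_le2 k -> 2%N \notin [pchar k] -> \tr x ^+ 2 != 4 ->
    \tr x != 0 \/ unit_squares k (-1) ->
  set_square (conj_class (bar x)) = setT.
Proof.
move=> u_le2 char2 t4 t0; apply/seteqP; split=> // X _.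
have [g ->] := bar_surj X.
have [/scalar_SL2 -> | nsg] := boolP (is_scalar_mx g); first exact: class_square_one.
have [s4|s4] := eqVneq (\tr g ^+ 2) 4; last exact: class_square_trace_ne.
have /eqP : \tr g ^+ 2 = 2 ^+ 2 by rewrite s4; ring.
rewrite eqf_sqr => /orP[]/eqP s2; first exact/class_square_trace2.
rewrite -(bar_opp g); have s2' : \tr (SL2_opp g) = 2 by rewrite /= raddfN /= s2 opprK.
apply/class_square_trace2 => //=.
by apply: contra nsg => /is_scalar_mxP[a gE]; apply/is_scalar_mxP; exists (- a);
  rewrite raddfN /= -gE opprK.
Qed.

(** Since [\det g = 1], the determinant of [g - 1] is [2 - \tr g], and it vanishes when [g - 1] is
    nilpotent. Conversely, Cayley-Hamilton gives [(g - 1) ^+ 2 = 0]. *)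
Lemma unipotentP g : unipotent g <-> \tr g = 2.
Proof.
split=> [|s2].
- case=> n /(congr1 determinant); rewrite -[_ - 1]/((g : 'M_2) - 1%:M).
  have dX (M : 'M[k]_2) m : \det (M ^+ m) = \det M ^+ m.
    by elim: m => [|m IHm]; rewrite ?expr0 ?det1 // !exprS det_mulmx IHm.
  rewrite dX det0 => /eqP; rewrite expf_eq0 => /andP[_ /eqP].
  move: (det_SL2 g); rewrite !det22 mxtrace22 !mxE /= mulr1n mulr0n => dg dg1.
  transitivity (2 + (g 0 0 * g 1 1 - g 0 1 * g 1 0 - 1)
                - ((g 0 0 - 1) * (g 1 1 - 1) - (g 0 1 - 0) * (g 1 0 - 0))); first by ring.
  by rewrite dg dg1 subrr addr0 subr0.
- exists 2%N; rewrite expr2 -[_ * _]/(((g : 'M_2) - 1%:M) *m ((g : 'M_2) - 1%:M)).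
  rewrite mulmxBl mulmxBr !mulmx1 mul1mx cayley_hamilton22 det_SL2 s2.
  by apply/matrixP => i j; rewrite !mxE; ring.
Qed.

Lemma class_square_unipotents x :
    u_invariant_le2 k -> 2%N \notin [pchar k] ->
    \tr x = 0 -> ~ unit_squares k (-1) ->
  set_square (conj_class (bar x)) = setT `\` unipotents k.
Proof.
move=> u_le2 char2 t0 n1.
have n2 : (2 : k) != 0 by apply: contra char2 => n2; rewrite inE.
have t4 : \tr x ^+ 2 != 4.
  have -> : 4 = 2 * 2 :> k by ring.
  by rewrite t0 expr0n eq_sym mulf_neq0.
have trace2 g : ~~ is_scalar_mx g -> \tr g = 2 ->
    ~ set_square (conj_class (bar x)) (bar g).
  by move=> nsg s2 /class_square_trace2[]//; rewrite t0 eqxx.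
apply/seteqP; split=> X.
- move=> CX; split=> // -[g /= [/unipotentP s2 g1] gX]; subst X.
  (* A scalar matrix of trace 2 is the identity, which [g1] excludes. *)
  apply: trace2 CX => //; apply/negP => /is_scalar_mxP[a gE]; apply: g1.
  apply: val_inj; rewrite /= gE; congr (_%:M).
  apply: (mulfI n2); rewrite mulr1 -[RHS]s2 gE mxtrace_scalar.
  by rewrite mulr_natl.
- case=> _; have [g ->] := bar_surj X => ng.
  have [s4|s4] := eqVneq (\tr g ^+ 2) 4; last exact: class_square_trace_ne.
  have [/scalar_SL2 -> | nsg] := boolP (is_scalar_mx g); first exact: class_square_one.
  (* One of [g] and its negative has trace 2, so it is a unipotent lift of [bar g], and it is not
     the identity. *)
  case: ng; have /eqP : \tr g ^+ 2 = 2 ^+ 2 by rewrite s4; ring.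
  rewrite eqf_sqr => /orP[]/eqP s2.
    exists g => //=; split; first exact/unipotentP.
    by move=> g1; case/is_scalar_mxP: nsg; exists 1; rewrite g1.
  exists (SL2_opp g); last exact: bar_opp.
  split; first by apply/unipotentP; rewrite /= raddfN /= s2 opprK.
  move=> g1; case/is_scalar_mxP: nsg; exists (-1).
  by have /= gE := congr1 val g1; rewrite -[LHS]opprK gE raddfN.
Qed.

(** * Trace zero and square roots of -1 *)

(** The eigenvalues are [d] and [- d] with product 1, so [d ^+ 2 = -1]. *)
Lemma split_trace0 x : split_semisimple x -> \tr x = 0 -> unit_squares k (-1).
Proof.
case=> _ [P uP] /diagonalizable_forPex[D] /(similarP uP) PxDP t0.
have xE : (x : 'M_2) = invmx P *m diag_mx D *m P by rewrite -mulmxA -PxDP mulKmx.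
have := det_SL2 x; move: t0.
rewrite xE -mulmxA mxtrace_mulC -mulmxA mulmxV // mulmx1 !det_mulmx mulrCA.
rewrite -det_mulmx mulVmx // det1 mulr1 mxtrace22 det22 !mxE /= !mulr1n !mulr0n.
move=> /eqP; rewrite addrC addr_eq0 mul0r subr0 => /eqP-> D2.
exists (D 0 0); last by rewrite expr2 -D2 mulrN opprK.
by apply: contra_eqN D2 => /eqP->; rewrite mul0r eq_sym oner_eq0.
Qed.

(** The characteristic polynomial is ['X^2 + 1], so a square root of -1 would give it a linear
    factor. *)
Lemma nonsplit_trace0 x :
  nonsplit_semisimple x -> \tr x = 0 -> ~ unit_squares k (-1).
Proof.
case=> _ [_ irr] t0 [i _ i2].
have pE : char_poly x = 'X^2 + 1%:P.
  apply/polyP => -[|[|[|n]]].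
  - by rewrite char_poly_det det_SL2 sqrrN expr1n mulr1 coefD coefXn coefC add0r.
  - rewrite (char_poly_trace _ (n := 2)) // t0 oppr0 coefD coefXn coefC addr0 //.
  - have := char_poly_monic x; rewrite monicE lead_coefE size_char_poly /= => /eqP->.
    by rewrite coefD coefXn coefC addr0.
  - by rewrite nth_default ?size_char_poly // coefD coefXn coefC addr0.
have := irr ('X - i%:P); rewrite size_XsubC => /(_ isT).
have -> : 'X - i%:P %| char_poly x.
  by rewrite dvdp_XsubCl pE rootE !hornerE i2 addNr.
by move=> /(_ isT)/eqp_size; rewrite size_XsubC size_char_poly.
Qed.

Lemma class_trace0 x : class_trace (conj_class (bar x)) = [set 0] <-> \tr x = 0.
Proof.
rewrite class_traceE; split=> [t0|->]; last by rewrite oppr0 setUid.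
by have : [set 0] (\tr x) by rewrite -t0; left.
Qed.

End Classes.

Theorem theorem1p1 (k : fieldType)
    (u_le2 : u_invariant_le2 k)
    (not_qclosed : ~ quadratically_closed k)
    (char_neq2 : 2%N \notin [pchar k])
    (card_ge5 : exists s : seq k, uniq s /\ (5 <= size s)%N)
    (C : set (PSL2 k)) (ssC : semisimple_class C) :
  [/\ split_semisimple_class C -> set_square C = setT,
      nonsplit_semisimple_class C ->
        (class_trace C <> [set 0] -> set_square C = setT) /\
        (class_trace C = [set 0] ->
           ~ unit_squares k (-1) /\
           set_square C = setT `\` unipotents k)
    & unit_squares k (-1) -> set_square C = setT].
Proof.
have squareT (x : SL2 k) : semisimple x -> \tr x != 0 \/ unit_squares k (-1) ->
    set_square (conj_class (bar x)) = setT.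
  by move=> /(semisimple_trace char_neq2) t4; apply: class_squareT.
split.
- case=> x sx ->; apply: squareT; first by case: sx.
  (* A split class of trace 0 is not exceptional, as -1 is then a square. *)
  by have [/(split_trace0 sx)|] := eqVneq (\tr x) 0; [right | left].
- case=> x nx ->; split=> [t0 | /class_trace0 t0].
    apply: squareT; first by case: nx.
    by left; apply/eqP => /class_trace0.
  by have n1 := nonsplit_trace0 nx t0; split; last exact: class_square_unipotents.
- by move=> n1; case: ssC => x sx ->; apply: squareT; last right.
Qed.
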